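(* Let $K_d$ be the complete graph on $d$ vertices, let $g=\frac{(d-1)(d-2)}{2}$, and let $(\gamma_r)_{r\geq 1}$ be the gonality sequence of $K_d$. Then for every integer $r\ge 1$: \[ \gamma_r=\begin{cases} kd-h & \text{if } r<g,\\ g+r & \text{if } r\geq g,\end{cases} \] where, in the case $r<g$, $k$ and $h$ are the uniquely determined integers with $1\leq k\leq d-3$ and $0\leq h\leq k$ such that $r=\frac{k(k+3)}{2}-h$.
   Context: Let $G$ be a finite graph without loop edges, with vertex set $V(G)$ and edge set $E(G)$. A divisor on $G$ is an element $D=\sum_{v\in V(G)}a_v(v)$ of the free abelian group on $V(G)$ (so $a_v\in\mathbb{Z}$; write $D(v)=a_v$). Its degree is $\deg(D)=\sum_v a_v$, and $D$ is effective ($D\ge 0$) if $a_v\geq 0$ for all $v$. For $f:V(G)\to\mathbb{Z}$, the principal divisor of $f$ is $\mathrm{div}(f)=\sum_{v\in V(G)}\big(\sum_{e=vw\in E(G)}(f(v)-f(w))\big)(v)$. Two divisors are linearly equivalent, $D_1\sim D_2$, if $D_1-D_2=\mathrm{div}(f)$ for some $f:V(G)\to\mathbb{Z}$. The linear system of $D$ is $|D|=\{E : E\geq 0,\ E\sim D\}$. The rank $\mathrm{rk}(D)$ is $-1$ if $|D|=\emptyset$; otherwise it is the largest integer $r\geq 0$ such that $|D-E|\neq\emptyset$ for every effective divisor $E$ of degree $r$. The gonality sequence $(\gamma_r)_{r\geq1}$ of $G$ is defined by $\gamma_r=\min\{s : \text{there exists a divisor on } G \text{ of degree } s \text{ and rank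 } r\}$. The number $g=\frac{(d-1)(d-2)}{2}$ is the genus of $K_d$. *)

(* Defs.v *)
From mathcomp Require Import all_boot all_order all_algebra.
Set Implicit Arguments.
Unset Strict Implicit.
Unset Printing Implicit Defensive.
Import Order.TTheory GRing.Theory Num.Theory.
Local Open Scope ring_scope.

(** A finite loopless graph, possibly with parallel edges: [mult v w] is the
    number of edges joining [v] and [w]. *)
Record graph := Graph {
  vertex :> finType;
  mult : vertex -> vertex -> nat;
  mult_sym : forall v w, mult v w = mult w v;
  mult_loopless : forall v, mult v v = 0%N
}.

(** The free abelian group on the finite set [vertex G], written as the group of
    integer-valued functions. *)
Notation divisor G := {ffun vertex G -> int}.

Section Divisors.
Variable G : graph.
Implicit Types (D E : divisor G) (r s : int).

Definition deg D : int := \sum_v D v.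

Definition effective D : Prop := forall v, 0 <= D v.

(** The sum over the edges [e = vw] at [v] is grouped by the other endpoint. *)
Definition principal (f : G -> int) : divisor G :=
  [ffun v => \sum_w (f v - f w) *+ mult v w].

Definition lin_equiv D1 D2 : Prop := exists f : G -> int, D1 - D2 = principal f.

Definition in_linear_system D E : Prop := effective E /\ lin_equiv E D.

Definition nonempty_system D : Prop := exists E, in_linear_system D E.

Definition rank_at_least D r : Prop :=
  forall E, effective E -> deg E = r -> nonempty_system (D - E).

(** [has_rank D r] is rk(D) = r; see [has_rank_inj]. *)
Definition has_rank D r : Prop :=
  (~ nonempty_system D /\ r = -1) \/
  [/\ nonempty_system D, 0 <= r, rank_at_least D r
    & forall r', 0 <= r' -> rank_at_least D r' -> r' <= r].

(** [is_gonality r s] is gamma_r = s, i.e. the minimum exists and equals [s]. *)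
Definition is_gonality r s : Prop :=
  (exists D, deg D = s /\ has_rank D r) /\
  (forall s', (exists D, deg D = s' /\ has_rank D r) -> s <= s').

Lemma has_rank_inj D r1 r2 : has_rank D r1 -> has_rank D r2 -> r1 = r2.
Proof.
case=> [[nD ->]|[D1 p1 R1 M1]]; case=> [[mD ->]|[D2 p2 R2 M2]] //.
by apply/le_anti; rewrite M2 // M1.
Qed.

Lemma is_gonality_inj r s1 s2 : is_gonality r s1 -> is_gonality r s2 -> s1 = s2.
Proof. by case=> e1 m1 [e2 m2]; apply/le_anti; rewrite m1 // m2. Qed.

End Divisors.

Section Complete.
Variable d : nat.

Definition complete_mult (v w : 'I_d) : nat := v != w.

Lemma complete_mult_sym v w : complete_mult v w = complete_mult w v.
Proof. by rewrite /complete_mult eq_sym. Qed.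

Lemma complete_mult_loopless v : complete_mult v v = 0%N.
Proof. by rewrite /complete_mult eqxx. Qed.

Definition complete_graph : graph :=
  Graph complete_mult_sym complete_mult_loopless.

(** Both integer divisions below are exact: the dividends are even. *)
Definition genus_complete : int := ((d%:Z - 1) * (d%:Z - 2) %/ 2)%Z.

Definition index_decomposition (r k h : int) : Prop :=
  [/\ 1 <= k <= d%:Z - 3, 0 <= h <= k & r = (k * (k + 3) %/ 2)%Z - h].

End Complete.

(* Main.v *)
Require Import Defs.
From mathcomp Require Import all_boot all_order all_algebra all_fingroup.
From mathcomp Require Import zify ring.
Set Implicit Arguments.
Unset Strict Implicit.
Unset Printing Implicit Defensive.
Import Order.TTheory GRing.Theory Num.Theory.
Local Open Scope ring_scope.

(** On the complete graph with [d] vertices, firing changes a divisor by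
    [d * f v - \sum_w f w], so two divisors of equal degree are equivalent exactly
    when their difference is constant modulo [d].  Everything reduces to
    arithmetic of residues modulo [d].  Below [d = n.+1], so that the genus is
    [n * (n - 1) / 2].

    Upper bounds.  Carrying [D + c] to the residues in [0, d) shows that [D] is
    equivalent to an effective divisor as soon as
    [c <= \sum_v floor ((D v + c) / d)] for some integer [c]
    ([nonempty_system_floor]).  Averaging this over [c], with Hermite's identity
    [\sum_(c < d) floor ((x + c) / d) = x], yields such a [c] when
    [deg D >= genus]; averaging over [0 <= c <= k] only yields one for
    [D = kd (v0) - E], for every effective [E] of degree [k (k + 3) / 2].  So the
    divisor [(kd - h) (v0)] has rank at least [k (k + 3) / 2 - h].

    Lower bounds.  A divisor whose residues modulo [d] are all distinct and
    whose degree is at most [genus - 1] is not equivalent to an effective one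
    ([permutation_residues_empty]).  Given [D], write [D = N + F] where [N] is
    such a divisor of degree [genus - 1], and choose the pair so that
    [\sum_v (F v)^2] is minimal.  Exchanging two residues that are consecutive
    modulo [d] cannot decrease this sum, which says that [F], listed cyclically
    in the order of the residues of [N], never drops by more than [1]
    ([exists_slowly_descending]).  Subtracting the positive part of [F] from [D]
    leaves a divisor below [N], so the rank of [D] is smaller than the degree [P]
    of that positive part.  If moreover the negative part, of degree [M], is
    nonzero, then [F] takes every value between its extremes, in particular [0];
    hence [P <= p (p + 1) / 2] and [M <= q (q + 1) / 2] where [p] and [q] count
    the positive and the negative values, and [p + q <= d - 1].  As
    [P - M = deg D - genus + 1], a degree below the claimed gonality makes both
    [P] and [M] too large for this. *)

(** * Linear equivalence on a complete graph *)

Lemma principal_complete d (f : complete_graph d -> int) v :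
  principal f v = d%:Z * f v - \sum_w f w.
Proof.
rewrite ffunE; transitivity (\sum_w (f v - f w)).
  apply: eq_bigr => w _ /=; rewrite /complete_mult.
  by case: eqVneq => [->|_]; rewrite ?subrr ?mulr0n.
by rewrite sumrB sumr_const card_ord -mulr_natl natz.
Qed.

Lemma deg_lin_equiv d (D1 D2 : divisor (complete_graph d)) :
  lin_equiv D1 D2 -> deg D1 = deg D2.
Proof.
case=> f e; apply/eqP; rewrite -subr_eq0 /deg -sumrB; apply/eqP.
transitivity (\sum_v (d%:Z * f v - \sum_w f w)).
  by apply: eq_bigr => v _; rewrite -principal_complete -e !ffunE.
by rewrite sumrB -mulr_sumr sumr_const card_ord -mulr_natl natz subrr.
Qed.

Lemma nonempty_system_le (G : graph) (D1 D2 : divisor G) :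
  (forall v, D1 v <= D2 v) -> nonempty_system D1 -> nonempty_system D2.
Proof.
move=> le12 [E [E0 [f e]]]; exists (E + (D2 - D1)); split.
  by move=> v; rewrite !ffunE addr_ge0 // subr_ge0.
by exists f; rewrite -e; apply/ffunP=> v; rewrite !ffunE; ring.
Qed.

(** Firing [floor ((D v + c) / d)] at each [v] replaces [D + c] by its residues,
    of sum at most [deg D]; the missing multiple of [d] goes to one vertex. *)
Lemma nonempty_system_floor n (D : divisor (complete_graph n.+1)) (c : int) :
  c <= \sum_v ((D v + c) %/ n.+1)%Z -> nonempty_system D.
Proof.
set S : int := \sum_v _ => cS.
pose f (v : 'I_n.+1) : int :=
  - ((D v + c) %/ n.+1)%Z + (if v == ord0 then S - c else 0).
have sf : \sum_v f v = - c.
  by rewrite big_split /= sumrN -big_mkcond big_pred1_eq -/S; ring.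
exists (D + principal (G := complete_graph n.+1) f); split.
  move=> v; rewrite ffunE principal_complete sf /f.
  have key (x s q e : int) : x + c = q * n.+1%:Z + e -> 0 <= e -> 0 <= s ->
      0 <= x + (n.+1%:Z * (- q + s) - - c) by nia.
  apply: (key _ _ _ _ (divz_eq _ _)); first exact: modz_ge0.
  by case: (v == ord0); rewrite ?subr_ge0.
by exists f; rewrite addrC addKr.
Qed.

(** * Averaging the floor criterion *)

(** Hermite's identity: replacing [x] by [x + 1] shifts the summands cyclically,
    except that the one which wraps around grows by [1]. *)
Lemma sum_floor_shift n (x : int) : \sum_(c < n.+1) ((x + c%:Z) %/ n.+1)%Z = x.
Proof.
have step y : \sum_(c < n.+1) ((y + 1 + c%:Z) %/ n.+1)%Z
            = \sum_(c < n.+1) ((y + c%:Z) %/ n.+1)%Z + 1.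
  rewrite big_ord_recr big_ord_recl /= addr0.
  have -> : y + 1 + n%:Z = y + 1 * n.+1%:Z by lia.
  rewrite divzDr ?dvdz_mull // mulzK // addrA; congr (_ + _); rewrite addrC.
  by congr (_ + _); apply: eq_bigr => i _; congr (_ %/ _)%Z; rewrite /bump; lia.
elim/int_rect: x => [|m IH|m IH].
- by apply: big1 => c _; rewrite add0r divz_nat divn_small.
- have -> : Posz m.+1 = m%:Z + 1 by lia.
  by rewrite step IH.
- by apply: (addIr 1); rewrite -step; have -> : - m.+1%:Z + 1 = - m%:Z by lia.
Qed.

Lemma exists_nonneg_term n (t : 'I_n.+1 -> int) :
  - n.+1%:Z < \sum_i t i -> exists i, 0 <= t i.
Proof.
move=> h; case: (pickP (fun i => 0 <= t i)) => [i ti|neg]; first by exists i.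
suff : \sum_i t i <= \sum_(i < n.+1) (-1) by rewrite sumr_const card_ord; lia.
by apply: ler_sum => i _; have := neg i; lia.
Qed.

Lemma sum_ord_double n : 2 * \sum_(i < n.+1) (i%:Z) = (n%:Z + 1) * n%:Z.
Proof.
elim: n => [|n IH]; first by rewrite big_ord1.
by rewrite big_ord_recr /= mulrDr IH; lia.
Qed.

(** By Hermite's identity the excess in the floor criterion, summed over
    [0 <= c < d], is [deg D - d (d - 1) / 2], which exceeds [- d] when [deg D] is at
    least the genus. *)
Lemma nonempty_system_large_degree n (D : divisor (complete_graph n.+1)) :
  n%:Z * (n%:Z - 1) <= 2 * deg D -> nonempty_system D.
Proof.
move=> hD.
pose t (c : 'I_n.+1) : int := \sum_v ((D v + c%:Z) %/ n.+1)%Z - c%:Z.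
have [c] : exists c, 0 <= t c.
  apply: exists_nonneg_term; rewrite /t sumrB exchange_big /=.
  rewrite (eq_bigr D) => [|v _]; last exact: sum_floor_shift.
  rewrite -[X in _ < X - _]/(deg D); have := sum_ord_double n.
  by move: (deg D) (\sum_(i < _) _ : int) hD => a b; lia.
by rewrite subr_ge0 => /nonempty_system_floor.
Qed.

(** The floors [floor ((c - E v) / d)] are nonpositive for [c < d], so the partial
    sum over [c <= k] is at least the full one, [- E v].  Hence the excess in the
    floor criterion, summed over [c <= k], is at least
    [k (k + 1) / 2 - k (k + 3) / 2 = - k]. *)
Lemma nonempty_system_multiple n k (E : divisor (complete_graph n.+1)) :
  (k <= n)%N -> effective E -> 2 * deg E <= k%:Z * (k%:Z + 3) ->
  nonempty_system (([ffun v => if v == ord0 then k%:Z * n.+1%:Z else 0]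
                     : divisor (complete_graph n.+1)) - E).
Proof.
move=> kn E0 hE; set D : divisor _ := _ - E.
pose t (c : 'I_k.+1) : int := k%:Z - c%:Z + \sum_v ((c%:Z - E v) %/ n.+1)%Z.
have [c tc] : exists c, 0 <= t c.
  apply: exists_nonneg_term; rewrite /t big_split /= sumrB exchange_big /=.
  have le v : - E v <= \sum_(c < k.+1) ((c%:Z - E v) %/ n.+1)%Z.
    rewrite -[leLHS](sum_floor_shift n).
    rewrite (big_ord_widen_cond n.+1 xpredT
      (fun c => ((c%:Z - E v) %/ n.+1)%Z)) //.
    rewrite [leRHS]big_mkcond /=; apply: ler_sum => c _.
    rewrite [- E v + _]addrC; case: ifP => // _.
    suff : ((c%:Z - E v) %/ n.+1 < 1)%Z by lia.
    by rewrite ltz_divLR // mul1r; have := E0 v; have := ltn_ord c; lia.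
  have : - deg E <= \sum_v \sum_(c < k.+1) ((c%:Z - E v) %/ n.+1)%Z.
    rewrite /deg -sumrN; by apply: ler_sum => w _; exact: (le w).
  have key (a b e : int) : 2 * a = (k%:Z + 1) * k%:Z -> 2 * e <= k%:Z * (k%:Z + 3) ->
      - e <= b -> - k.+1%:Z < k%:Z *+ k.+1 - a + b by rewrite -mulr_natl natz; lia.
  by rewrite sumr_const card_ord; apply: key hE; apply: sum_ord_double.
apply: (@nonempty_system_floor _ _ c%:Z).
rewrite -subr_ge0; suff -> : \sum_v ((D v + c%:Z) %/ n.+1)%Z - c%:Z = t c by [].
rewrite /t; transitivity (\sum_(v : 'I_n.+1)
    ((if v == ord0 then k%:Z else 0) + ((c%:Z - E v) %/ n.+1)%Z) - c%:Z).
  congr (_ - _); apply: eq_bigr => v _; rewrite !ffunE.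
  case: eqP => _; last by rewrite !add0r addrC.
  by rewrite -addrA [- _ + _]addrC divzMDl.
by rewrite big_split -big_mkcond big_pred1_eq addrAC.
Qed.

(** * Divisors with distinct residues *)

Lemma modz_le (x m : int) : 0 < m -> 0 <= x -> (x %% m)%Z <= x.
Proof.
move=> m0 x0; rewrite [leRHS](divz_eq x m) lerDr mulr_ge0 ?(ltW m0) //.
by rewrite divz_ge0.
Qed.

(** Every divisor equivalent to [N] again has all residues modulo [d] distinct;
    if it is effective, its degree is at least the sum of these residues. *)
Lemma permutation_residues_empty n (p : {perm 'I_n.+1})
    (N : divisor (complete_graph n.+1)) :
  (forall i, (n.+1 %| N (p i) - i%:Z)%Z) -> deg N < \sum_(i < n.+1) i%:Z ->
  ~ nonempty_system N.
Proof.
move=> hN hdeg [X [X0 XN]]; have := deg_lin_equiv XN; case: XN => f e.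
set c := \sum_w f w in e *.
have Xi i : (n.+1 %| X (p i) - (- c + i%:Z))%Z.
  have := congr1 (fun g : divisor (complete_graph n.+1) => g (p i)) e.
  rewrite principal_complete !ffunE => e'.
  have key (x y a b : int) : x - y = n.+1%:Z * a - b ->
      x - (- b + i%:Z) = y - i%:Z + a * n.+1%:Z by lia.
  rewrite (key _ _ _ _ e').
  by rewrite rpredD // dvdz_mull.
apply/eqP; rewrite gt_eqF //; apply: lt_le_trans hdeg _.
rewrite /deg [leRHS](reindex_inj (perm_inj (s := p))) /=.
 have -> : \sum_(i < n.+1) i%:Z = \sum_(i < n.+1) ((- \sum_w f w + i%:Z) %% n.+1)%Z.
  rewrite /modz sumrB -mulr_suml sum_floor_shift big_split /= sumr_const card_ord.
  by rewrite -mulr_natr natz; ring.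
apply: ler_sum => i _; have := Xi i; rewrite -eqz_mod_dvd => /eqP <-.
by apply: modz_le.
Qed.

(** The vertex [p i] receives the residue [i]; the remainder [F i] is prescribed
    modulo [d] only, and its sum is the one for which the subtracted divisor has
    degree [genus - 1].  If [F i - 1 > F (i + 1)], exchanging the residues
    [i] and [i + 1] turns [(F i, F (i + 1))] into [(F (i + 1) + 1, F i - 1)] and
    decreases the sum of squares, so a minimal choice descends slowly. *)
Lemma exists_slowly_descending n (D : 'I_n.+1 -> int) :
  exists (p : {perm 'I_n.+1}) (F : 'I_n.+1 -> int),
  [/\ forall i, (n.+1 %| D (p i) - F i - i%:Z)%Z,
      \sum_i F i = \sum_i D i - \sum_(i < n.+1) i%:Z + n.+1%:Z
    & forall i, F i - 1 <= F (ordS i)].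
Proof.
set T : int := _ - _ + _.
pose ok (p : {perm 'I_n.+1}) (F : 'I_n.+1 -> int) :=
  (forall i, (n.+1 %| D (p i) - F i - i%:Z)%Z) /\ \sum_i F i = T.
suff descent m : forall p F, ok p F -> (`|(\sum_i F i ^+ 2)%R| < m)%N ->
    exists p F, ok p F /\ forall i, F i - 1 <= F (ordS i).
  pose F0 (i : 'I_n.+1) : int := D i - i%:Z + (if i == ord0 then n.+1%:Z else 0).
  have ok0 : ok 1%g F0.
    split=> [i|]; last by rewrite big_split sumrB -big_mkcond big_pred1_eq.
    rewrite perm1 /F0; case: (i == ord0).
        have -> : D i - (D i - i%:Z + n.+1%:Z) - i%:Z = - n.+1%:Z by ring.
      by rewrite rpredN.
    by have -> : D i - (D i - i%:Z + 0) - i%:Z = 0 by ring.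
  by have [p [F [[h1 h2] h3]]] := descent _ _ _ ok0 (ltnSn _); exists p, F.
elim: m => // m IH p F [okF sF] mF.
case: (pickP (fun i => ~~ (F i - 1 <= F (ordS i)))) => [i|good]; last first.
  by exists p, F; split=> // i; have := good i; case: (_ <= _).
rewrite -ltNge; set j := ordS i => hij.
have ij : i != j by apply/eqP=> ij; move: hij; rewrite -ij; lia.
pose F' l := if l == i then F j + 1 else if l == j then F i - 1 else F l.
have sum2 (H : 'I_n.+1 -> int) :
    \sum_l H l = H i + (H j + \sum_(l | (l != i) && (l != j)) H l).
  by rewrite (bigD1 i) // (bigD1 j) //= eq_sym.
have F'i : F' i = F j + 1 by rewrite /F' eqxx.
have F'j : F' j = F i - 1 by rewrite /F' eq_sym (negPf ij) eqxx.
have F'l l : (l != i) && (l != j) -> F' l = F l.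
  by rewrite /F' => /andP[/negPf -> /negPf ->].
apply: (IH (tperm i j * p)%g F').
  split=> [l|]; last first.
    by rewrite -sF !sum2 F'i F'j (eq_bigr F) //; ring.
  have jE : (n.+1 %| i%:Z + 1 - j%:Z)%Z.
    by rewrite -eqz_mod_dvd /j /= -modz_nat modz_mod /=; apply/eqP; congr (_ %% _)%Z; lia.
  rewrite permM /F'.
  case: tpermP => [->|->|/eqP/negPf -> /eqP/negPf ->].
  - rewrite eqxx.
    have -> : D (p j) - (F j + 1) - i%:Z
            = D (p j) - F j - j%:Z - (i%:Z + 1 - j%:Z) by ring.
    by rewrite rpredB.
  - rewrite eq_sym (negPf ij) eqxx.
    have -> : D (p i) - (F i - 1) - j%:Z
            = D (p i) - F i - i%:Z + (i%:Z + 1 - j%:Z) by ring.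
    by rewrite rpredD.
  - exact: okF.
suff lt : \sum_l F' l ^+ 2 < \sum_l F l ^+ 2.
  have : 0 <= \sum_l F' l ^+ 2 by apply: sumr_ge0 => l _; apply: sqr_ge0.
  lia.
rewrite !sum2 F'i F'j (eq_bigr (fun l => F l ^+ 2)) => [|l /F'l -> //].
rewrite !addrA ltrD2r; nia.
Qed.

(** * Positive and negative parts of a slowly descending cyclic sequence *)

(** Walking cyclically from [i] to [j], the first value that is at most [a]
    equals [a], since no step skips a value downwards. *)
Lemma descending_intermediate_value n (F : 'I_n.+1 -> int) i j a :
  (forall i, F i - 1 <= F (ordS i)) -> F j <= a <= F i -> exists l, F l = a.
Proof.
move=> desc /andP[ja ai].
have iterE m (u : 'I_n.+1) : iter m (@ordS n.+1) u = ((u + m) %% n.+1)%N :> nat.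
  elim: m => [|m IH] /=; first by rewrite addn0 modn_small.
  by rewrite IH -addn1 modnDml addn1 addnS.
have jE : j = iter (j + n.+1 - i) (@ordS n.+1) i.
  apply: val_inj; rewrite /= iterE subnKC ?modnDr ?modn_small //.
  by rewrite (leq_trans (ltnW (ltn_ord i))) ?leq_addl.
move: ja; rewrite jE; move: (_ - _)%N => m ja; elim: m i ai ja {jE} => [|m IH] i ai ja.
  by exists i; apply/le_anti; rewrite ai ja.
have [ea|ne] := eqVneq (F i) a; first by exists i.
by apply: (IH (ordS i)); [have := desc i; lia|rewrite -iterSr].
Qed.

(** A positive value [F i] is at most one more than the number of indices with
    smaller positive values, because each of [1, ..., F i - 1] is attained.
    Summing over the [p] indices with positive value counts each pair with
    different values once, so the sum is at most [p + p (p - 1) / 2]. *)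
Lemma double_sum_positive_part (I : finType) (F : I -> int) :
  (forall i a, 0 < a <= F i -> exists j, F j = a) ->
  let p := #|[pred i | 0 < F i]|%:Z in
  2 * \sum_i Num.max (F i) 0 <= p * (p + 1).
Proof.
move=> gapfree; set S := [pred i | 0 < F i]. set p := Posz _; rewrite /=.
pose below i := #|[pred j | 0 < F j < F i]|; pose above i := #|[pred j | F i < F j]|.
have level (m : nat) i : m.+1%:Z <= F i -> (m <= #|[pred j | (0 < F j < m.+1%:Z)%R]|)%N.
  elim: m => // m IH hm; have [j Fj] := gapfree i m.+1%:Z ltac:(lia).
  apply: (leq_ltn_trans (IH ltac:(lia))); apply: proper_card.
  apply/properP; split; first by apply/subsetP => l; rewrite !inE; lia.
  by exists j; rewrite !inE Fj; lia.
have sumS : \sum_i Num.max (F i) 0 = \sum_(i in S) F i.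
  by rewrite [RHS]big_mkcond; apply: eq_bigr => i _; rewrite inE; case: ltP => ?; lia.
have le1 : \sum_(i in S) F i <= \sum_(i in S) (1 + (below i)%:Z).
  apply: ler_sum => i; rewrite inE => Fi.
  have := level `|F i - 1|%N i ltac:(lia); rewrite /below.
  have -> : (`|F i - 1|%N.+1)%:Z = F i by lia.
  lia.
have sumAB : (\sum_(i in S) below i = \sum_(i in S) above i)%N.
  transitivity (\sum_(i in S) \sum_(j in S) ((F j < F i)%R : nat))%N.
    apply: eq_bigr => i _; rewrite /below -sum1_card big_mkcond [RHS]big_mkcond /=.
    by apply: eq_bigr => j _; rewrite !inE; case: (0 < F j); case: (_ < _).
  rewrite exchange_big; apply: eq_bigr => i; rewrite inE => Fi.
  rewrite /above -sum1_card big_mkcond [RHS]big_mkcond /=.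
  apply: eq_bigr => j _; rewrite !inE.
  by case: (F i < F j) / ltP => Fj; case: ifP => //; lia.
have le2 i : i \in S -> (below i + above i + 1 <= #|S|)%N.
  move=> iS; have := iS; rewrite inE => Fi.
  rewrite (cardD1 i S) iS -(cardID [pred j | F j < F i]) addnC leq_add2l.
  by apply: leq_add; apply: subset_leq_card; apply/subsetP => j; rewrite !inE;
    have [->|] := eqVneq j i; lia.
have : (\sum_(i in S) (below i + above i + 1) <= \sum_(i in S) #|S|)%N by apply: leq_sum.
rewrite !big_split /= -sumAB !sum_nat_const => le3.
rewrite sumS; move: le1; rewrite big_split /= sumr_const -/p.
rewrite -(big_morph Posz PoszD (erefl (Posz 0))) [_%:R]natz /p.
by move: (\sum_(i in S) F i : int) (\sum_(i in S) below i)%N #|S| le3 => x b m; nia.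
Qed.

(** When both signs occur the value [0] occurs too, which takes one index away
    from those counted by [p] and [q]. *)
Lemma descending_positive_negative_parts n (F : 'I_n.+1 -> int) :
  (forall i, F i - 1 <= F (ordS i)) ->
  0 < \sum_i Num.max (F i) 0 -> 0 < \sum_i Num.max (- F i) 0 ->
  exists p q : int, [/\ 0 <= p, 0 <= q, p + q <= n%:Z,
    2 * \sum_i Num.max (F i) 0 <= p * (p + 1)
    & 2 * \sum_i Num.max (- F i) 0 <= q * (q + 1)].
Proof.
move=> desc P0 M0.
have witness (H : 'I_n.+1 -> int) : 0 < \sum_i Num.max (H i) 0 -> exists i, 0 < H i.
  move=> H0; case: (pickP (fun i => 0 < H i)) => [i Hi|neg]; first by exists i.
  by move: H0; rewrite big1 // => i _; have := neg i; case: ltP => //; lia.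
have [i Fi] := witness _ P0; have [j Fj] := witness _ M0.
have [z Fz] : exists z, F z = 0.
  by apply: (descending_intermediate_value (i := i) (j := j)) => //; lia.
exists #|[pred i | 0 < F i]|%:Z, #|[pred i | 0 < - F i]|%:Z; split=> //.
- rewrite -PoszD lez_nat -cardUI.
  rewrite [X in (_ + X)%N]eq_card0 => [|l]; last by rewrite !inE; lia.
  rewrite addn0 -ltnS -[X in (_ < X)%N]card_ord; apply: proper_card.
  by apply/properP; split; [apply/subsetP | exists z; rewrite // !inE Fz].
- apply: double_sum_positive_part => l a ha.
  by apply: (descending_intermediate_value (i := l) (j := z)) => //; lia.
- apply: (double_sum_positive_part (F := fun l => - F l)) => l a ha.
  have [u Fu] : exists u, F u = - a; last by exists u; rewrite Fu opprK.
  by apply: (descending_intermediate_value (i := z) (j := l)) => //; lia.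
Qed.

(** * Upper bounds for the rank *)

(** [P] and [M] are the degrees of the positive and negative part of the
    remainder [F] of [D] modulo distinct residues.  The rank is below [P] because
    subtracting the positive part of [F] from [D] leaves an empty system. *)
Lemma rank_at_least_triangular n (D : divisor (complete_graph n.+1)) r :
  rank_at_least D r -> exists P M : int,
  [/\ r < P, 2 * (P - M) = 2 * deg D - n%:Z * (n%:Z - 1) + 2
    & 0 < P -> 0 < M -> exists p q : int, [/\ 0 <= p, 0 <= q, p + q <= n%:Z,
        2 * P <= p * (p + 1) & 2 * M <= q * (q + 1)]].
Proof.
move=> rkD; have [p [F [hp sF desc]]] := exists_slowly_descending D.
exists (\sum_i Num.max (F i) 0), (\sum_i Num.max (- F i) 0).
split; last exact: descending_positive_negative_parts; last first.
  have -> : \sum_i Num.max (F i) 0 - \sum_i Num.max (- F i) 0 = \sum_i F i.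
    by rewrite -sumrB; apply: eq_bigr => i _; lia.
  have := sum_ord_double n; move: sF; rewrite -/(deg D).
  by move: (deg D) (\sum_i F i : int) (\sum_(i < n.+1) i%:Z : int) => a b c; lia.
rewrite ltNge; apply/negP => Pr.
(* The multiple of the point [ord0] brings [E] to degree exactly [r]. *)
pose E : divisor (complete_graph n.+1) := [ffun v => Num.max (F ((p^-1)%g v)) 0
  + (if v == ord0 then r - \sum_i Num.max (F i) 0 else 0)].
have E0 : effective E.
  by move=> v; rewrite ffunE addr_ge0 ?le_max ?lexx ?orbT //; case: ifP; rewrite ?subr_ge0.
have degE : deg E = r.
  rewrite /deg (eq_bigr _ (fun v _ => ffunE _ v)) big_split -big_mkcond big_pred1_eq /=.
  rewrite (reindex_inj (perm_inj (s := p))) /=.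
  by under eq_bigr do rewrite permK; rewrite addrC subrK.
pose N : divisor (complete_graph n.+1) := [ffun v => D v - F ((p^-1)%g v)].
have Nempty : ~ nonempty_system N.
  apply: (permutation_residues_empty (p := p)) => [i|].
    by rewrite ffunE permK.
  rewrite /deg (eq_bigr _ (fun v _ => ffunE _ v)) sumrB.
  rewrite [X in _ - X](reindex_inj (perm_inj (s := p))) /=.
  under [X in _ - X]eq_bigr do rewrite permK.
  have key (a b : int) : a - (a - b + n.+1%:Z) < b by lia.
  by rewrite sF; apply: key.
apply: Nempty; apply: (nonempty_system_le _ (rkD E E0 degE)) => v.
rewrite !ffunE lerD2l lerN2 -[leLHS]addr0 lerD ?le_max ?lexx //.
by case: ifP; rewrite ?subr_ge0.
Qed.

(** The hypotheses force [2 * P > k (k + 1)] and [2 * M > m (m + 1)] with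
    [m = n - 1 - k], hence [p >= k + 1] and [q >= m + 1], against [p + q <= n].
    A negative [h] is meaningful: [h = - 1] shows that [(kd) (v0)] has rank no
    larger than [k (k + 3) / 2]. *)
Lemma rank_bound_small_degree n (D : divisor (complete_graph n.+1)) (r k h : int) :
  0 <= k -> k <= n%:Z - 1 -> h <= k -> k * (k + 3) <= 2 * (r + h) ->
  deg D < k * n.+1%:Z - h -> ~ rank_at_least D r.
Proof.
move=> k0 kn hk rE sD /rank_at_least_triangular[P [M [rP PM]]].
have P2 : k * (k + 1) + 2 <= 2 * P by nia.
have M2 : (n%:Z - 1 - k) * (n%:Z - k) + 2 <= 2 * M by nia.
have kk : 0 <= k * (k + 1) by nia.
have mm : 0 <= (n%:Z - 1 - k) * (n%:Z - k) by nia.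
case; [lia|lia|] => p [q [p0 q0 pq hP hM]].
have : k + 1 <= p by rewrite leNgt; apply/negP => ?; nia.
have : n%:Z - k <= q by rewrite leNgt; apply/negP => ?; nia.
lia.
Qed.

(** The degree bound forces [M > 0], so [q >= 1] and [p <= n - 1], and [P] cannot
    exceed the genus. *)
Lemma rank_bound_large_rank n (D : divisor (complete_graph n.+1)) (r : int) :
  n%:Z * (n%:Z - 1) <= 2 * r -> 2 * deg D < n%:Z * (n%:Z - 1) + 2 * r ->
  ~ rank_at_least D r.
Proof.
move=> rg sD /rank_at_least_triangular[P [M [rP PM]]].
have nn : 0 <= n%:Z * (n%:Z - 1) by nia.
case; [lia|lia|] => p [q [p0 q0 pq hP hM]].
have q1 : 1 <= q by rewrite leNgt; apply/negP => ?; have : q = 0; nia.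
nia.
Qed.

(** * The gonality sequence *)

Lemma is_gonality_intro (G : graph) (D : divisor G) (r : int) :
  0 <= r -> rank_at_least D r -> (exists v : G, true) ->
  (forall r', r < r' -> ~ rank_at_least D r') ->
  (forall D' : divisor G, deg D' < deg D -> ~ rank_at_least D' r) ->
  is_gonality G r (deg D).
Proof.
move=> r0 rkD [v0 _] maxr minD; split.
  exists D; split=> //; right; split=> // [|r' _ rkr']; last first.
    by rewrite leNgt; apply/negP => /maxr; apply.
  pose E : divisor G := [ffun v => if v == v0 then r else 0].
  have E0 : effective E by move=> v; rewrite ffunE; case: ifP.
  apply: (nonempty_system_le _ (rkD E E0 _)) => [v|].
    by rewrite !ffunE lerBlDr lerDl; case: ifP.
  by rewrite /deg (eq_bigr _ (fun v _ => ffunE _ v)) -big_mkcond big_pred1_eq.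
move=> s' [D' [degD' [[_ r1]|[_ _ rkD' _]]]]; first by move: r0; rewrite r1.
by rewrite -degD' leNgt; apply/negP => /minD; apply.
Qed.

Lemma mul_succ_even (x : int) : (2 %| x * (x + 1))%Z.
Proof.
have := divz_eq x 2; have := ltz_pmod x (isT : 0 < 2%:Z).
have := modz_ge0 x (isT : 2%:Z != 0).
move: (x %/ 2)%Z (x %% 2)%Z => q e e0 e2 xE.
have [e_0|e_1] : e = 0 \/ e = 1 by lia.
  by apply/dvdzP; exists (q * (x + 1)); rewrite {1}xE e_0; ring.
by apply/dvdzP; exists (x * (q + 1)); rewrite [in x + 1]xE e_1; ring.
Qed.

Lemma double_genus n : 2 * genus_complete n.+1 = n%:Z * (n%:Z - 1).
Proof.
rewrite mulrC /genus_complete divzK; first by lia.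
have -> : (n.+1%:Z - 1) * (n.+1%:Z - 2) = (n%:Z - 1) * (n%:Z - 1 + 1) by lia.
exact: mul_succ_even.
Qed.

Lemma double_index_quotient (k : int) : 2 * (k * (k + 3) %/ 2)%Z = k * (k + 3).
Proof.
rewrite mulrC divzK //; have -> : k * (k + 3) = k * (k + 1) + k * 2 by ring.
by rewrite rpredD ?mul_succ_even ?dvdz_mull.
Qed.

Lemma index_decomposition_unique d (r k h k' h' : int) :
  index_decomposition d r k h -> index_decomposition d r k' h' -> k' = k /\ h' = h.
Proof.
case=> /andP[k1 _] /andP[h0 hk] rE [/andP[k'1 _] /andP[h'0 hk'] rE'].
have := double_index_quotient k; have := double_index_quotient k'.
move: (_ %/ 2)%Z (_ %/ 2)%Z rE rE' => a b -> rE' aE bE.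
have kk : k' = k.
  by apply/le_anti; apply/andP; split; rewrite leNgt; apply/negP => ?; nia.
by subst k'; lia.
Qed.

(** [k] is the least index with [r <= k (k + 3) / 2]; the values
    [k (k + 3) / 2 - h], [0 <= h <= k], fill the gap after the previous one. *)
Lemma index_decomposition_exists n (r : int) :
  1 <= r < genus_complete n.+1 -> exists k h, index_decomposition n.+1 r k h.
Proof.
case/andP=> r1 rg; have := double_genus n => gE.
have n3 : (3 <= n)%N by rewrite leqNgt; apply/negP => ?; nia.
have ex : exists m : nat, 2 * r <= m%:Z * (m%:Z + 3).
  (* [d - 3 = n - 2] works: its value is [genus - 1]. *)
  by exists (n - 2)%N; rewrite -subzn; [nia|lia].
case: (ex_minnP ex) => m hm minm.
have mn : (m <= n - 2)%N by apply: minm; rewrite -subzn; [nia|lia].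
have m1 : (1 <= m)%N by case: m hm {minm mn}; lia.
have hm' : m.-1%:Z * (m.-1%:Z + 3) < 2 * r.
  by rewrite ltNge; apply/negP => /minm; lia.
exists m%:Z, ((m%:Z * (m%:Z + 3) %/ 2)%Z - r).
have := double_index_quotient m; move: (_ %/ 2)%Z => a aE.
have mE : m.-1%:Z = m%:Z - 1 by lia.
rewrite mE in hm'; split; [lia| |lia].
by apply/andP; split; lia.
Qed.

Lemma deg_point n (a : int) :
  deg ([ffun v => if v == ord0 then a else 0] : divisor (complete_graph n.+1)) = a.
Proof.
by rewrite /deg (eq_bigr _ (fun v _ => ffunE _ v)) -big_mkcond big_pred1_eq.
Qed.

Lemma degB (G : graph) (D E : divisor G) : deg (D - E) = deg D - deg E.
Proof. by rewrite /deg -sumrB; apply: eq_bigr => v _; rewrite !ffunE. Qed.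

Lemma gonality_small_rank n (r k h : int) : 1 <= r ->
  index_decomposition n.+1 r k h ->
  is_gonality (complete_graph n.+1) r (k * n.+1%:Z - h).
Proof.
move=> r1 [/andP[k1 kn] /andP[h0 hk] rE]; have := double_index_quotient k.
move: (_ %/ 2)%Z rE => T rE TE.
pose D : divisor (complete_graph n.+1) :=
  [ffun v => if v == ord0 then k * n.+1%:Z - h else 0].
rewrite -[X in is_gonality _ _ X](deg_point n) -/D.
have degD : deg D = k * n.+1%:Z - h by apply: deg_point.
apply: is_gonality_intro.
- lia.
- move=> E E0 degE.
  (* Both [E] and the [h] points removed from [(kd) (v0)] go into [E']. *)
  pose E' : divisor (complete_graph n.+1) :=
    E + [ffun v => if v == ord0 then h else 0].
  have E'0 : effective E'.
    by move=> v; rewrite !ffunE addr_ge0 //; case: ifP.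
  have degE' : deg E' = r + h.
    rewrite -degE -[in RHS](deg_point n h) /deg -big_split.
    by apply: eq_bigr => v _; rewrite !ffunE.
  have := @nonempty_system_multiple n `|k|%N E' ltac:(lia) E'0
    ltac:(rewrite degE'; lia).
  apply: nonempty_system_le => v; rewrite !ffunE gez0_abs; last by lia.
  by rewrite opprD addrA addrAC; case: ifP; rewrite ?subrr ?subr0.
- by exists (ord0 : 'I_n.+1).
- (* The bound for [r + 1], whose decomposition is [(k, h - 1)]. *)
  move=> r' rr'; apply: (@rank_bound_small_degree _ _ _ k (h - 1)); lia.
- by move=> D'; rewrite degD => sD'; apply: (@rank_bound_small_degree _ _ _ k h); lia.
Qed.

Lemma gonality_large_rank n (r : int) : 0 <= r -> genus_complete n.+1 <= r ->
  is_gonality (complete_graph n.+1) r (genus_complete n.+1 + r).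
Proof.
move=> r0 gr; have gE := double_genus n.
rewrite -[X in is_gonality _ _ X](deg_point n).
set D : divisor (complete_graph n.+1) := [ffun _ => _].
have degD : deg D = genus_complete n.+1 + r by apply: deg_point.
apply: is_gonality_intro => //.
- by move=> E _ degE; apply: nonempty_system_large_degree; rewrite degB degD degE; lia.
- by exists (ord0 : 'I_n.+1).
- by move=> r' rr'; apply: rank_bound_large_rank; lia.
- by move=> D'; rewrite degD => sD'; apply: rank_bound_large_rank; lia.
Qed.

Theorem theorem1 (d : nat) (hd : (1 <= d)%N) (r : int) (hr : 1 <= r) :
  (r < genus_complete d ->
     exists k h : int,
       [/\ index_decomposition d r k h,
           (forall k' h' : int, index_decomposition d r k' h' -> k' = k /\ h' = h)
         & is_gonality (complete_graph d) r (k * d%:Z - h)]) /\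
  (genus_complete d <= r ->
     is_gonality (complete_graph d) r (genus_complete d + r)).
Proof.
case: d hd => // n _; split=> rg.
  have [k [h khP]] : exists k h, index_decomposition n.+1 r k h.
    by apply: index_decomposition_exists; rewrite hr.
  exists k, h; split=> // [k' h'|]; first exact: index_decomposition_unique.
  exact: gonality_small_rank.
by apply: gonality_large_rank rg; apply: le_trans hr.
Qed.
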